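(* Every dynamic decision problem $\mathcal{D}$ in the class $\mathsf{NP}^{dy}$ admits an algorithm-family $\mathcal{A}=\{\mathcal{A}_n\}_n$ that solves $\mathcal{D}$ with update time $O(\mathrm{polylog}(n))$ and space complexity $O(\mathrm{poly}(n))$, and that uses an oracle-family $\mathcal{O}'$ for the First Shallow Decision Tree problem ($\text{First-DT}^{dy}$) with blow-up size $O(2^{\mathrm{polylog}(n)})$.
   Context: Model: the bit-probe model. A dynamic problem has $n$-bit instances; an algorithm $\mathcal{A}_n$ receives an initial instance $I_0$ at step $0$ (preprocessing) and then at each step $t\ge 1$ an instance-update $(I_{t-1},I_t)$ (encodable in $O(\log n)$ bits), and must output the answer for $I_t$; it must be correct for $\mathrm{poly}(n)$ many update steps. Update time = maximum number of memory bit-probes per update step; space complexity = number of memory bits. An algorithm may use an oracle $\mathcal{O}_m$ for a problem $\mathcal{D}'$ as a black box (feeding it an initial instance and instance-updates of $\mathcal{D}'$ and reading its answer); oracle calls cost nothing towards update time and the oracle's memory does not count towards space. The algorithm-family uses an oracle-family with blow-up size $b(n)$ if $\mathcal{A}_n$ only uses oracles $\mathcal{O}_m$ with $m\le b(n)$. $\mathsf{NP}^{dy}$: a decision problem $\mathcal{D}$ is in $\mathsf{NP}^{dy}$ iff there is a verifier-family $\mathcal{V}$ with update time $O(\mathrm{polylog}(n))$ and space $O(\mathrm{poly}(n))$ such that: at step $0$, $\mathcal{V}_n$ gets $I_0$ and outputs $(x_0,y_0)$; at each step $t\ge1$ it gets $((I_{t-1},I_t),\pi_t)$ with a proof $\pi_t\in\{0,1\}^{\mathrm{polylog}(n)}$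 and outputs $(x_t,y_t)$ with $x_t\in\{0,1\}$ and reward $y_t\in\{0,1\}^{\mathrm{polylog}(n)}$; (1) for every proof-sequence, $x_t=0$ whenever $\mathcal{D}_n(I_t)=0$; (2) if the proof-sequence is reward-maximizing (each $\pi_t$, given the history, maximizes $y_t$ viewed as an integer), then $x_t=1$ whenever $\mathcal{D}_n(I_t)=1$. $\text{First-DT}^{dy}$: an instance is a pair $(\mathrm{mem}_I,\mathcal{T}_I)$ where $\mathrm{mem}_I$ is a bit array and $\mathcal{T}_I$ is a collection of decision trees (with read/write/end nodes) all operating on $\mathrm{mem}_I$, each of depth $O(\mathrm{polylog}|\mathcal{T}_I|)$, and each leaf $v$ carries a rank $r(v)\in\{0,1\}^{\mathrm{polylog}|\mathcal{T}_I|}$ independent of memory contents. For $T\in\mathcal{T}_I$ let $v^*_T$ be the leaf reached by the execution path of $T$ on $\mathrm{mem}_I$; the answer is the tree $T\in\mathcal{T}_I$ maximizing $r(v^*_T)$. An instance-update flips one bit of $\mathrm{mem}_I$ (the trees stay fixed). This is a search (non-decision) problem. *)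

(* Defs.v *)
From HB Require Import structures.
From mathcomp Require Import all_boot.

Set Implicit Arguments.
Unset Strict Implicit.
Unset Printing Implicit Defensive.

Definition bigO (f g : nat -> nat) : Prop :=
  exists c n0, forall n, n0 <= n -> f n <= c * g n.

Definition O_polylog (f : nat -> nat) : Prop :=
  exists k, bigO f (fun n => trunc_log 2 n ^ k).

Definition O_poly (f : nat -> nat) : Prop :=
  exists k, bigO f (fun n => n ^ k).

Definition O_quasipoly (f : nat -> nat) : Prop :=
  exists2 g, O_polylog g & bigO f (fun n => 2 ^ g n).

(* Binary numbers are written least significant bit first. *)
Fixpoint bval (s : seq bool) : nat :=
  if s is b :: s' then b + (bval s').*2 else 0.

Fixpoint bits (w a : nat) : seq bool :=
  if w is w'.+1 then odd a :: bits w' a./2 else [::].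

Definition bitlen (n : nat) : nat := (trunc_log 2 n).+1.

Lemma size_bits w a : size (bits w a) = w.
Proof. by elim: w a => //= w IH a; rewrite IH. Qed.

Lemma bitsK w a : a < 2 ^ w -> bval (bits w a) = a.
Proof.
elim: w a => [|w IH] a /=; first by rewrite expn0; case: a.
move=> lta; rewrite IH ?odd_double_half //.
by rewrite -ltn_double -!muln2 -expnSr (leq_ltn_trans _ lta)// muln2 -{2}(odd_double_half a) leq_addl.
Qed.

Lemma bval_inj s1 s2 : size s1 = size s2 -> bval s1 = bval s2 -> s1 = s2.
Proof.
elim: s1 s2 => [|b1 s1 IH] [|b2 s2] //= [eqs] eqv.
have eqb : b1 = b2.
  by have := congr1 odd eqv; rewrite !oddD !odd_double !addbF; case: b1 b2 {eqv} => [] [].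
subst b2; move/addnI/double_inj: eqv => eqv.
by rewrite (IH s2).
Qed.

Lemma ltn_bitlen a n : a <= n -> a < 2 ^ bitlen n.
Proof. by move=> le_an; apply: leq_ltn_trans le_an (trunc_log_ltn _ _). Qed.

Lemma bitlen_log : bigO bitlen (trunc_log 2).
Proof.
exists 2, 2 => n n_ge2; rewrite /bitlen mul2n -addnn -addn1 leq_add2l.
by rewrite trunc_log_gt0.
Qed.

(* [next I u = Some J] means that (I, J) is an instance-update and that u is  *)
(* its encoding; [next_inj] makes the encoding of an instance-update unique.  *)
Record dynBase := DynBase {
  inst : nat -> Type;
  icode : forall n, inst n -> n.-tuple bool;
  icode_inj : forall n, injective (@icode n);
  ulen : nat -> nat;
  ulen_log : bigO ulen (trunc_log 2);
  next : forall n, inst n -> (ulen n).-tuple bool -> option (inst n);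
  next_inj : forall n (I J : inst n) u v,
    next I u = Some J -> next I v = Some J -> u = v }.

Notation upd D n := ((ulen D n).-tuple bool).

Fixpoint nexts (D : dynBase) n (I : inst D n) (us : seq (upd D n)) :
    option (inst D n) :=
  if us is u :: us' then
    if next I u is Some J then nexts J us' else None
  else Some I.

Record decProblem := DecProblem {
  dbase :> dynBase;
  accepts : forall n, inst dbase n -> bool }.

(* An instance of a search problem may have several correct answers, but it   *)
(* always has one, so that correct oracles exist.                             *)
Record searchProblem := SearchProblem {
  sbase :> dynBase;
  alen : nat -> nat;
  answer : forall n, inst sbase n -> (alen n).-tuple bool -> Prop;
  answer_total : forall n (I : inst sbase n), exists a, answer I a }.

Inductive dtree (A L : Type) : Type :=
| End of L
| Read of A & dtree A L & dtree A L
| Write of A & bool & dtree A L.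

Fixpoint depth A L (t : dtree A L) : nat :=
  match t with
  | End _ => 0
  | Read _ t0 t1 => (maxn (depth t0) (depth t1)).+1
  | Write _ _ t' => (depth t').+1
  end.

Fixpoint exec (A : eqType) L (t : dtree A L) (m : A -> bool) : (A -> bool) * L :=
  match t with
  | End l => (m, l)
  | Read a t0 t1 => if m a then exec t1 m else exec t0 m
  | Write a b t' => exec t' [eta m with a |-> b]
  end.

Section Verifier.
Variables (D : dynBase) (n : nat).

(* The memory cells: the input arrays for the instance-update and the proof,  *)
(* the output arrays for x and y, and w further cells.                        *)
Definition vcell (p r w : nat) : finType :=
  ('I_(ulen D n) + 'I_p + unit + 'I_r + 'I_w)%type.

Definition vcell_x p r w : vcell p r w := inl (inl (inr tt)).
Definition vcell_y p r w (i : 'I_r) : vcell p r w := inl (inr i).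

Record verifier := Verifier {
  plen : nat;
  rlen : nat;
  vwork : nat;
  vinit : inst D n -> vcell plen rlen vwork -> bool;
  vtree : dtree (vcell plen rlen vwork) unit }.

Variable V : verifier.

Definition vmem := vcell (plen V) (rlen V) (vwork V) -> bool.
Notation prf := ((plen V).-tuple bool).
Definition vtime : nat := depth (vtree V).
Definition vspace : nat := #|vcell (plen V) (rlen V) (vwork V)|.

Definition vx (m : vmem) : bool := m (vcell_x _ _ _).
Definition vy (m : vmem) : nat := bval [seq m (vcell_y _ _ i) | i : 'I_(rlen V)].

Definition vinput (u : upd D n) (p : prf)
    (m : vmem) : vmem := fun a =>
  match a with
  | inl (inl (inl (inl i))) => tnth u i
  | inl (inl (inl (inr i))) => tnth p i
  | _ => m a
  end.

Definition vstep (m : vmem) (up : upd D n * prf) :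
    vmem := (exec (vtree V) (vinput up.1 up.2 m)).1.

Definition vrun (I0 : inst D n) ups : vmem := foldl vstep (vinit I0) ups.

Fixpoint reward_max (m : vmem)
    (ups : seq (upd D n * prf)) : Prop :=
  if ups is (u, p) :: ups' then
    (forall p', vy (vstep m (u, p')) <= vy (vstep m (u, p)))
    /\ reward_max (vstep m (u, p)) ups'
  else True.

End Verifier.

(* K n is the number of update steps to be supported on instances of size n.  *)
(* [ups] lists the pairs (instance-update, proof) of the steps 1, ..., t; as  *)
(* it is arbitrary, all steps t <= K n are covered.                           *)
Definition verifies (K : nat -> nat) (D : decProblem) (V : forall n, verifier D n) :
    Prop :=
  forall n (I0 I : inst D n)
    (ups : seq (upd D n * (plen (V n)).-tuple bool)),
  size ups <= K n -> nexts I0 (unzip1 ups) = Some I ->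
  (accepts I = false -> vx (vrun I0 ups) = false)
  /\ (reward_max (vinit I0) ups -> accepts I = true -> vx (vrun I0 ups) = true).

Definition NPdy (K : nat -> nat) (D : decProblem) : Prop :=
  exists V : forall n, verifier D n,
    [/\ O_polylog (fun n => vtime (V n)),
        O_poly (fun n => vspace (V n)),
        O_polylog (fun n => plen (V n)),
        O_polylog (fun n => rlen (V n))
      & verifies K V].

(* An oracle maps an initial instance and the updates received so far to the  *)
(* current answer; it is free to break ties depending on this history.        *)
Definition oracle_family (S : searchProblem) : Type :=
  forall m, inst S m -> seq (upd S m) -> (alen S m).-tuple bool.

Definition oracle_correct (S : searchProblem) (O : oracle_family S) : Prop :=
  forall m (I0 I : inst S m) us, nexts I0 us = Some I -> answer I (O m I0 us).

(* [OCall j] sends the content of the query array of oracle j to that oracle  *)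
(* and overwrites its answer array with the reply; it is not a memory probe.  *)
Inductive otree (A J : Type) : Type :=
| OEnd
| ORead of A & otree A J & otree A J
| OWrite of A & bool & otree A J
| OCall of J & otree A J.

Fixpoint probes A J (t : otree A J) : nat :=
  match t with
  | OEnd => 0
  | ORead _ t0 t1 => (maxn (probes t0) (probes t1)).+1
  | OWrite _ _ t' => (probes t').+1
  | OCall _ t' => probes t'
  end.

Section OracleAlgorithm.
Variables (D : dynBase) (S : searchProblem) (n : nat).

(* The memory cells: the input array for the instance-update, the output bit, *)
(* for each oracle j (of instance size m j) an array for the encoding of the  *)
(* update fed to it and an array for its answer, and w further cells.         *)
Definition acell k (m : 'I_k -> nat) (w : nat) : finType :=
  ('I_(ulen D n) + unit + {j : 'I_k & 'I_(ulen S (m j))}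
   + {j : 'I_k & 'I_(alen S (m j))} + 'I_w)%type.

Record oalgorithm := OAlgorithm {
  norc : nat;
  osize : 'I_norc -> nat;
  awork : nat;
  oinit : inst D n -> forall j, inst S (osize j);
  ainit : inst D n -> acell osize awork -> bool;
  atree : otree (acell osize awork) 'I_norc }.

Variable A : oalgorithm.

Definition amem := acell (@osize A) (awork A) -> bool.
Definition ahist := forall j : 'I_(norc A), seq (upd S (osize j)).
Definition atime : nat := probes (atree A).
Definition aspace : nat := #|acell (@osize A) (awork A)|.

Definition acell_out : acell (@osize A) (awork A) := inl (inl (inl (inr tt))).
Definition acell_query (j : 'I_(norc A)) (i : 'I_(ulen S (osize j))) :
    acell (@osize A) (awork A) :=
  inl (inl (inr (Tagged (fun j => 'I_(ulen S (osize j))) i))).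

Definition aout (m : amem) : bool := m acell_out.
Definition aquery (m : amem) j : upd S (osize j) :=
  [tuple m (acell_query i) | i < ulen S (osize j)].

Definition ainput (u : upd D n) (m : amem) : amem := fun a =>
  if a is inl (inl (inl (inl i))) then tnth u i else m a.

Variables (O : oracle_family S) (I0 : inst D n).

Definition aanswer (m : amem) (h : ahist) (j : 'I_(norc A)) : amem := fun a =>
  if a is inl (inr (existT j' i)) then
    if j' == j then tnth (O (oinit I0 j') (h j')) i else m a
  else m a.

(* None: an oracle was fed something that encodes no instance-update. *)
Fixpoint oexec (t : otree (acell (@osize A) (awork A)) 'I_(norc A))
    (m : amem) (h : ahist) : option (amem * ahist) :=
  match t with
  | OEnd => Some (m, h)
  | ORead a t0 t1 => if m a then oexec t1 m h else oexec t0 m h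
  | OWrite a b t' => oexec t' [eta m with a |-> b] h
  | OCall j t' =>
      let h' : ahist := dfwith h (rcons (h j) (aquery m j)) in
      if nexts (oinit I0 j) (h' j) is Some _ then oexec t' (aanswer m h' j) h'
      else None
  end.

Definition astart : amem * ahist :=
  let h : ahist := fun=> [::] in
  (foldl (fun m j => aanswer m h j) (ainit I0) (enum 'I_(norc A)), h).

Definition astep (st : option (amem * ahist)) (u : upd D n) :=
  if st is Some (m, h) then oexec (atree A) (ainput u m) h else None.

Definition arun (us : seq (upd D n)) : option (amem * ahist) :=
  foldl astep (Some astart) us.

End OracleAlgorithm.

Definition solves_with_oracle (K : nat -> nat) (D : decProblem) (S : searchProblem)
    (A : forall n, oalgorithm D S n) : Prop :=
  forall O : oracle_family S, oracle_correct O ->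
  forall n (I0 I : inst D n) us,
    size us <= K n -> nexts I0 us = Some I ->
    exists m h, arun (A n) O I0 us = Some (m, h) /\ aout m = accepts I.

Definition blowup (D : decProblem) (S : searchProblem)
    (A : forall n, oalgorithm D S n) (b : nat -> nat) : Prop :=
  forall n (j : 'I_(norc (A n))), osize j <= b n.

Section FirstDT.

(* With k trees, the depth is at most [dbound k], the rank length [rbound k]. *)
Variables dbound rbound : nat -> nat.

Notation rtree := (dtree nat (seq bool)).

(* The memory array (cells 0, ..., size - 1) and the list of trees. *)
Definition fdt_raw : Type := (seq bool * seq rtree)%type.

Definition rank (I : fdt_raw) (T : rtree) : nat :=
  bval (exec T (nth false I.1)).2.

Fixpoint tree_wf (M r : nat) (t : rtree) : bool :=
  match t with
  | End l => size l == r
  | Read a t0 t1 => [&& a < M, tree_wf M r t0 & tree_wf M r t1]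
  | Write a _ t' => (a < M) && tree_wf M r t'
  end.

Definition fdt_wf (I : fdt_raw) : bool :=
  (0 < size I.2)
  && all (fun t => tree_wf (size I.1) (rbound (size I.2)) t
                   && (depth t <= dbound (size I.2))) I.2.

(* Self-delimiting bit encodings; an instance of size m is one that [ser]     *)
(* encodes in exactly m bits.                                                 *)
Definition ser_mem (s : seq bool) : seq bool :=
  foldr (fun b c => true :: b :: c) [:: false] s.

Definition ser_nat (k : nat) : seq bool := rcons (nseq k true) false.

Fixpoint ser_tree (w : nat) (t : rtree) : seq bool :=
  match t with
  | End l => [:: false; false] ++ l
  | Read a t0 t1 => [:: false; true] ++ bits w a ++ ser_tree w t0 ++ ser_tree w t1
  | Write a b t' => [:: true; b] ++ bits w a ++ ser_tree w t'
  end.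

Definition ser (I : fdt_raw) : seq bool :=
  ser_mem I.1 ++ ser_nat (size I.2)
  ++ flatten [seq ser_tree (bitlen (size I.1)) t | t <- I.2].

Lemma ser_mem_inj s1 s2 c1 c2 :
  ser_mem s1 ++ c1 = ser_mem s2 ++ c2 -> s1 = s2 /\ c1 = c2.
Proof.
elim: s1 s2 => [|b1 s1 IH] [|b2 s2] //=; first by case.
by case=> -> /IH[-> ->].
Qed.

Lemma ser_nat_inj k1 k2 c1 c2 :
  ser_nat k1 ++ c1 = ser_nat k2 ++ c2 -> k1 = k2 /\ c1 = c2.
Proof.
elim: k1 k2 => [|k1 IH] [|k2] //=; first by case.
by case=> /IH[-> ->].
Qed.

Lemma cat_inj_size T (s1 s2 c1 c2 : seq T) :
  size s1 = size s2 -> s1 ++ c1 = s2 ++ c2 -> s1 = s2 /\ c1 = c2.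
Proof.
move=> eqs eqc; have := congr1 (take (size s1)) eqc.
rewrite take_size_cat // eqs take_size_cat // => ->; split=> //.
by have := congr1 (drop (size s1)) eqc; rewrite drop_size_cat // eqs drop_size_cat.
Qed.

Lemma bits_inj w a1 a2 c1 c2 : a1 < 2 ^ w -> a2 < 2 ^ w ->
  bits w a1 ++ c1 = bits w a2 ++ c2 -> a1 = a2 /\ c1 = c2.
Proof.
move=> lt1 lt2 /cat_inj_size[|eqb ->]; first by rewrite !size_bits.
by split=> //; rewrite -(bitsK lt1) eqb bitsK.
Qed.

Lemma ser_tree_inj w M r t1 t2 c1 c2 : M <= 2 ^ w ->
  tree_wf M r t1 -> tree_wf M r t2 ->
  ser_tree w t1 ++ c1 = ser_tree w t2 ++ c2 -> t1 = t2 /\ c1 = c2.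
Proof.
move=> leMw; have ltw a : a < M -> a < 2 ^ w by move/leq_trans; apply.
elim: t1 t2 c1 c2 => [l1|a1 t IHt t' IHt'|a1 b1 t IHt].
- case=> [l2|a2 s s'|a2 b2 s] c1 c2 //= /eqP sz1 /eqP sz2 [].
  by case/cat_inj_size; rewrite ?sz1 ?sz2 // => -> ->.
- case=> [l2|a2 s s'|a2 b2 s] c1 c2 //= /and3P[h1 h2 h3] /and3P[g1 g2 g3] [].
  rewrite -!catA => /(bits_inj (ltw _ h1) (ltw _ g1))[-> /(IHt _ _ _ h2 g2)[->]].
  by case/(IHt' _ _ _ h3 g3) => -> ->.
- case=> [l2|a2 s s'|a2 b2 s] c1 c2 //= /andP[h1 h2] /andP[g1 g2] [->].
  by rewrite -!catA => /(bits_inj (ltw _ h1) (ltw _ g1))[-> /(IHt _ _ _ h2 g2)[-> ->]].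
Qed.

Lemma ser_inj I1 I2 : fdt_wf I1 -> fdt_wf I2 -> ser I1 = ser I2 -> I1 = I2.
Proof.
case: I1 I2 => [m1 ts1] [m2 ts2] /andP[_ /= wf1] /andP[_ /= wf2].
move=> /ser_mem_inj /= [eqm /ser_nat_inj[eqk]].
move=> eqs; subst m2; rewrite -eqk in wf2; suff -> : ts1 = ts2 by [].
move: (rbound _) (dbound _) wf1 wf2 => r d.
elim: ts1 ts2 eqk eqs => [|t1 ts1 IH] [|t2 ts2] //= [eqk] eqs.
move=> /andP[/andP[h1 _] h2] /andP[/andP[g1 _] g2].
by have [-> eqs'] := ser_tree_inj (ltnW (ltn_bitlen (leqnn _))) h1 g1 eqs; rewrite (IH ts2).
Qed.

Definition fdt_inst (m : nat) : Type :=
  {I : fdt_raw | fdt_wf I && (size (ser I) == m)}.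

Lemma fdt_size m (I : fdt_inst m) : size (ser (val I)) == m.
Proof. by case: I => I /= /andP[]. Qed.

Definition fdt_code m (I : fdt_inst m) : m.-tuple bool := Tuple (fdt_size I).

Lemma fdt_code_inj m : injective (@fdt_code m).
Proof.
move=> I1 I2 /(congr1 val) /= eqs; apply: val_inj; apply: ser_inj eqs.
  by case: I1 => I /= /andP[].
by case: I2 => I /= /andP[].
Qed.

Definition flip (I : fdt_raw) (i : nat) : fdt_raw :=
  (set_nth false I.1 i (~~ nth false I.1 i), I.2).

Lemma size_ser_mem s : size (ser_mem s) = (size s).*2.+1.
Proof. by elim: s => //= b s ->. Qed.

Lemma size_flip I i : i < size I.1 -> size (flip I i).1 = size I.1.
Proof. by move=> lti; rewrite size_set_nth; apply/maxn_idPr. Qed.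

Lemma flip_subproof m (I : fdt_inst m) i : i < size (val I).1 ->
  fdt_wf (flip (val I) i) && (size (ser (flip (val I) i)) == m).
Proof.
case: I => I /= hI lti.
by move: hI; rewrite /fdt_wf /ser !size_cat !size_ser_mem size_flip.
Qed.

Definition fdt_next m (I : fdt_inst m) (u : (bitlen m).-tuple bool) :
    option (fdt_inst m) :=
  if @idP (bval u < size (val I).1) is ReflectT lti then
    Some (exist _ (flip (val I) (bval u)) (flip_subproof lti))
  else None.

Lemma fdt_next_inj m (I J : fdt_inst m) u v :
  fdt_next I u = Some J -> fdt_next I v = Some J -> u = v.
Proof.
rewrite /fdt_next; case: {-}_ / idP => // lt1 [<-]; case: {-}_ / idP => // lt2 [].
move/(congr1 (fun s => nth false s (bval u))); rewrite !nth_set_nth /= eqxx.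
case: eqP => [eqv _|_]; last by case: nth.
by apply: val_inj; apply: bval_inj; rewrite ?size_tuple.
Qed.

Definition fdt_base : dynBase :=
  DynBase fdt_code_inj bitlen_log fdt_next_inj.

(* The answer is the index, in binary, of any one of the trees of max rank. *)
Definition fdt_answer m (I : fdt_inst m) (a : (bitlen m).-tuple bool) : Prop :=
  bval a < size (val I).2
  /\ forall i, i < size (val I).2 ->
       rank (val I) (nth (End nat [::]) (val I).2 i)
       <= rank (val I) (nth (End nat [::]) (val I).2 (bval a)).

Lemma fdt_answer_total m (I : fdt_inst m) : exists a, fdt_answer I a.
Proof.
have kgt0 : 0 < size (val I).2 by case: I => I /= /andP[/andP[]].
have lekm : size (val I).2 <= m.
  apply: leq_trans (eq_leq (eqP (fdt_size I))).
  rewrite /ser !size_cat size_rcons size_nseq.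
  by rewrite addnCA addSn ltnW // ltnS leq_addr.
pose F (i : 'I_(size (val I).2)) := rank (val I) (nth (End nat [::]) (val I).2 i).
case: (@arg_maxnP _ (Ordinal kgt0) predT F isT) => i _ imax.
have szi : size (bits (bitlen m) i) == bitlen m by rewrite size_bits.
have vali : bval (Tuple szi) = i.
  apply: bitsK; apply: ltn_bitlen; exact: leq_trans (ltnW (ltn_ord i)) lekm.
exists (Tuple szi); rewrite /fdt_answer vali.
by split=> // j ltj; apply: (imax (Ordinal ltj)).
Qed.

Definition FirstDT : searchProblem :=
  @SearchProblem fdt_base bitlen fdt_answer fdt_answer_total.

End FirstDT.

(* Main.v *)
(** A single First-DT oracle finds the reward-maximizing proof.  Its memory
    array is a copy of the verifier's memory, and for every proof [p] it has a
    tree that writes [p] into the proof cells, runs the verifier's tree and ends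
    in a leaf ranked by the reward cells it then reads.  Once the new
    instance-update has been copied into that array, the index of a best tree is
    a reward-maximizing proof; the algorithm runs the verifier on it, forwarding
    every changed bit to the oracle, and outputs the verifier's bit [x].  Using
    [2 ^ L] trees, with repetitions, where [L] bounds the proof length, the
    depth and the reward length, lets both polylogarithmic bounds of First-DT be
    the binary logarithm, whatever the exponents of the verifier are.          *)

From mathcomp Require Import all_boot zify.
Require Import Defs.

Set Implicit Arguments.
Unset Strict Implicit.
Unset Printing Implicit Defensive.

(** * Binary numerals, instance-updates, and bit arrays indexed by a finite type *)

Lemma bval_lt s : bval s < 2 ^ size s.
Proof.
elim: s => //= b s IH; rewrite expnS mul2n.
by move: IH; case: b => /=; lia.
Qed.

Lemma bits_bval s : bits (size s) (bval s) = s.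
Proof. by apply: bval_inj; rewrite ?size_bits // bitsK // bval_lt. Qed.

Lemma bval_pad s j : bval (s ++ nseq j false) = bval s.
Proof. by elim: s => /= [|b s ->] //; elim: j => //= j ->. Qed.

Lemma nexts_rcons (D : dynBase) n (I : inst D n) us u :
  nexts I (rcons us u) = if nexts I us is Some J then next J u else None.
Proof.
elim: us I => [|v us IH] I /=; first by case: next.
by case: next.
Qed.

Lemma fdt_nextP db rb m (I : fdt_inst db rb m) (u : (bitlen m).-tuple bool) :
  bval u < size (val I).1 ->
  exists2 J, fdt_next I u = Some J & val J = flip (val I) (bval u).
Proof.
by rewrite /fdt_next => ltu; case: {-}_ / idP => // ltu'; eexists.
Qed.

Lemma nth_map_enum (A : finType) (f : A -> bool) a :
  nth false [seq f x | x <- enum A] (enum_rank a) = f a.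
Proof.
rewrite (nth_map a) ?nth_enum_rank //.
by rewrite -cardE (leq_trans (ltn_ord _)).
Qed.

Lemma map_enum_ranks (A : finType) (f : A -> bool) i : i < #|A| ->
  exists2 a, i = enum_rank a & nth false [seq f x | x <- enum A] i = f a.
Proof.
move=> lti; exists (enum_val (Ordinal lti)); first by rewrite enum_valK.
by rewrite -[f _]nth_map_enum enum_valK.
Qed.

(** First-DT updates only flip bits, so a write corresponds to an update exactly when it changes the
    cell; hence the hypothesis [f a != b]. *)
Lemma flip_map_enum (A : finType) (f : A -> bool) a b ts : f a != b ->
  flip ([seq f x | x <- enum A], ts) (enum_rank a)
  = ([seq [eta f with a |-> b] x | x <- enum A], ts).
Proof.
move=> neq; rewrite /flip /=; congr pair.
have ltA : enum_rank a < #|A| by [].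
have szA g : size [seq (g : A -> bool) x | x <- enum A] = #|A|.
  by rewrite size_map -cardE.
have szS : size (set_nth false [seq f x | x <- enum A] (enum_rank a)
  (~~ nth false [seq f x | x <- enum A] (enum_rank a))) = #|A|.
  by rewrite size_set_nth szA; apply/maxn_idPr.
apply: (@eq_from_nth _ false); rewrite szS ?szA // => i lti.
rewrite nth_set_nth /= nth_map_enum.
case: (map_enum_ranks [eta f with a |-> b] lti) => c -> ->.
rewrite nth_map_enum /= (inj_eq val_inj) (inj_eq enum_rank_inj).
by case: (c == a); move: neq; case: (f a); case: b.
Qed.

(** * Decision trees: composition, execution and encoded length *)

Section Trees.
Variable A : finType.

Definition writes (s : seq A) (v : A -> bool) (t : dtree A unit) :=
  foldr (fun a t => Write a (v a) t) t s.

Lemma depth_writes s v t : depth (writes s v t) = size s + depth t.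
Proof. by elim: s => //= a s ->. Qed.

Lemma exec_ext (t : dtree A unit) m1 m2 :
  m1 =1 m2 -> (exec t m1).1 =1 (exec t m2).1.
Proof.
elim: t m1 m2 => [l|a t0 IH0 t1 IH1|a b t IH] m1 m2 eqm //=.
  by rewrite eqm; case: (m2 a); [apply: IH1 | apply: IH0].
by apply: IH => c /=; rewrite eqm.
Qed.

Lemma exec_writes s v t m :
  (exec (writes s v t) m).1
  =1 (exec t (fun a => if a \in s then v a else m a)).1.
Proof.
elim: s m => [|a s IH] m //= c; rewrite IH; apply: exec_ext => {}c /=.
by rewrite in_cons; case: eqP => [->|] //=; case: ifP.
Qed.

(** Leaves of [t] carry no information, so grafting [k] onto each of them is sequential composition.
    The numbering is that of the array [[seq f a | a <- enum A]]. *)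
Fixpoint renum L (t : dtree A unit) (k : dtree nat L) : dtree nat L :=
  match t with
  | End _ => k
  | Read a t0 t1 => Read (enum_rank a : nat) (renum t0 k) (renum t1 k)
  | Write a b t => Write (enum_rank a : nat) b (renum t k)
  end.

(** A rank may not depend on the memory, so there is one leaf for each possible content of the cells
    read, labelled by a function of that content. *)
Fixpoint read_seq (s : seq nat) (k : seq bool -> seq bool) : dtree nat (seq bool) :=
  if s is a :: s' then
    Read a (read_seq s' (fun l => k (false :: l))) (read_seq s' (fun l => k (true :: l)))
  else End nat (k [::]).

Lemma depth_renum L t (k : dtree nat L) : depth (renum t k) = depth t + depth k.
Proof. by elim: t => //= [a t0 -> t1 ->|a b t ->] //; rewrite addSn addn_maxl. Qed.

Lemma exec_renum L t (k : dtree nat L) m (f : A -> bool) :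
  (forall a, m (enum_rank a : nat) = f a) ->
  exists2 m', (forall a, m' (enum_rank a : nat) = (exec t f).1 a)
            & exec (renum t k) m = exec k m'.
Proof.
elim: t m f => [l|a t0 IH0 t1 IH1|a b t IH] m f eqm /=.
- by exists m.
- by rewrite eqm; case: (f a); [apply: IH1 | apply: IH0].
- by apply: IH => c /=; rewrite eqm (inj_eq val_inj) (inj_eq enum_rank_inj).
Qed.

Lemma wf_renum M r t k : #|A| <= M -> tree_wf M r k -> tree_wf M r (renum t k).
Proof.
move=> leM wfk; elim: t => //= [a t0 -> t1 ->|a b t ->].
  by rewrite !andbT (leq_trans (ltn_ord _)).
by rewrite andbT (leq_trans (ltn_ord _)).
Qed.

Lemma depth_read_seq s k : depth (read_seq s k) = size s.
Proof. by elim: s k => //= a s IH k; rewrite !IH maxnn. Qed.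

Lemma exec_read_seq s k m : exec (read_seq s k) m = (m, k (map m s)).
Proof. by elim: s k => //= a s IH k; rewrite !IH; case: (m a). Qed.

Lemma wf_read_seq M r s k : all (fun a => a < M) s ->
  (forall l, size l = size s -> size (k l) = r) -> tree_wf M r (read_seq s k).
Proof.
elim: s k => [|a s IH] k /=; first by move=> _ szk; rewrite szk.
by case/andP=> -> alls szk; rewrite !IH // => l szl; apply: szk; rewrite /= szl.
Qed.

End Trees.

(** A node takes at most [2 + w + r] bits, and a tree of depth [d] has at most [2 ^ d.+1 - 1] nodes.
    The summand on the left stands for the missing node and pays for the root in the induction. *)
Lemma size_ser_tree M r w t : tree_wf M r t ->
  size (ser_tree w t) + (2 + w + r) <= 2 ^ (depth t).+1 * (2 + w + r).
Proof.
elim: t => [l /eqP|a t0 IH0 t1 IH1 /and3P[_ wf0 wf1]|a b t IH /andP[_ wft]] /=.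
- by move=> ->; rewrite expn1; lia.
- rewrite !size_cat size_bits.
  have le2 d1 d2 : d1 <= d2 -> 2 ^ d1.+1 * (2 + w + r) <= 2 ^ d2.+1 * (2 + w + r).
    by move=> led; rewrite leq_mul2r leq_pexp2l ?orbT.
  have := leq_trans (IH0 wf0) (le2 _ _ (leq_maxl _ (depth t1))).
  have := leq_trans (IH1 wf1) (le2 _ _ (leq_maxr (depth t0) _)).
  by rewrite [2 ^ (maxn _ _).+2]expnS; lia.
- rewrite !size_cat size_bits; have := IH wft.
  have : 2 ^ 1 <= 2 ^ (depth t).+1 by rewrite leq_pexp2l.
  by rewrite [2 ^ (depth t).+2]expnS; nia.
Qed.

(** * Closure properties of polylogarithmic and polynomial bounds *)

Lemma O_polylog_le f g : (forall n, f n <= g n) -> O_polylog g -> O_polylog f.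
Proof.
move=> le_fg [k [c [n0 H]]]; exists k, c, n0 => n /H; exact: leq_trans.
Qed.

Lemma log_exp_le n j k : 1 < n -> j <= k -> trunc_log 2 n ^ j <= trunc_log 2 n ^ k.
Proof. by move=> n1 le_jk; rewrite leq_pexp2l // trunc_log_gt0. Qed.

Lemma O_polylogD f g : O_polylog f -> O_polylog g -> O_polylog (fun n => f n + g n).
Proof.
move=> [k1 [c1 [n1 H1]]] [k2 [c2 [n2 H2]]].
(* The extra 2 makes the logarithm positive, so that exponents may be raised. *)
exists (k1 + k2), (c1 + c2), (n1 + n2 + 2) => n len.
have h1 : f n <= c1 * _ := H1 n ltac:(lia).
have h2 : g n <= c2 * _ := H2 n ltac:(lia).
have l1 := @log_exp_le n k1 (k1 + k2) ltac:(lia) ltac:(lia).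
have l2 := @log_exp_le n k2 (k1 + k2) ltac:(lia) ltac:(lia).
rewrite mulnDl leq_add //.
  by apply: leq_trans h1 _; rewrite leq_mul2l l1 orbT.
by apply: leq_trans h2 _; rewrite leq_mul2l l2 orbT.
Qed.

Lemma O_polylogM f g : O_polylog f -> O_polylog g -> O_polylog (fun n => f n * g n).
Proof.
move=> [k1 [c1 [n1 H1]]] [k2 [c2 [n2 H2]]].
exists (k1 + k2), (c1 * c2), (n1 + n2) => n len.
by rewrite expnD mulnACA leq_mul ?H1 ?H2 //; lia.
Qed.

Lemma O_polylog_cst c : O_polylog (fun=> c).
Proof. by exists 0, c, 0 => n _; rewrite expn0 muln1. Qed.

Lemma O_polylog_log f : bigO f (trunc_log 2) -> O_polylog f.
Proof. by move=> [c [n0 H]]; exists 1, c, n0 => n; rewrite expn1; apply: H. Qed.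

(** The logarithm of [c * n ^ k] is at most [bitlen c + k * bitlen n]. *)
Lemma O_polylog_bitlen f : O_poly f -> O_polylog (fun n => bitlen (f n)).
Proof.
move=> [k [c [n0 H]]].
pose g n := bitlen c + k * bitlen n + 1.
have Pg : O_polylog g.
  apply: O_polylogD; last exact: O_polylog_cst.
  apply: O_polylogD; first exact: O_polylog_cst.
  apply: O_polylogM; first exact: O_polylog_cst.
  exact/O_polylog_log/bitlen_log.
case: Pg => k' [c' [n1 H']]; exists k', c', (n0 + n1) => n len.
apply: leq_trans (H' n ltac:(lia)).
rewrite /g addn1 ltnS; set X := _ + _.
rewrite -[X](@trunc_expnK 2) //; apply: leq_trunc_log.
apply: leq_trans (H n ltac:(lia)) _.
rewrite expnD leq_mul ?(ltnW (ltn_bitlen _)) //.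
rewrite mulnC expnM; case: (k) => [|k0]; first by rewrite !expn0.
by rewrite leq_exp2r // ltnW ?ltn_bitlen.
Qed.

(** The logarithm of [n] is itself at most [n], so the same exponent serves. *)
Lemma O_poly_polylog f : O_polylog f -> O_poly f.
Proof.
move=> [k [c [n0 H]]]; exists k, c, n0.+1 => n len.
apply: leq_trans (H n ltac:(lia)) _; rewrite leq_mul2l; apply/orP; right.
case: k {H} => [|k]; first by rewrite !expn0.
rewrite leq_exp2r //; apply: leq_trans (ltnW (ltn_expl _ (isT : 1 < 2))) _.
by apply: trunc_logP; lia.
Qed.

Lemma O_polyD f g : O_poly f -> O_poly g -> O_poly (fun n => f n + g n).
Proof.
move=> [k1 [c1 [n1 H1]]] [k2 [c2 [n2 H2]]].
exists (k1 + k2), (c1 + c2), (n1 + n2).+1 => n len.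
have h1 : f n <= c1 * _ := H1 n ltac:(lia).
have h2 : g n <= c2 * _ := H2 n ltac:(lia).
rewrite mulnDl leq_add //.
  apply: leq_trans h1 _; rewrite leq_mul2l leq_pexp2l ?orbT //; lia.
by apply: leq_trans h2 _; rewrite leq_mul2l leq_pexp2l ?orbT //; lia.
Qed.

(** * Writing and reading blocks of cells in oracle trees *)

Section OracleTrees.
Variables (A : eqType) (J : Type).

Definition owrites (s : seq A) (v : A -> bool) (t : otree A J) :=
  foldr (fun a t => OWrite a (v a) t) t s.

Lemma probes_owrites s v t : probes (owrites s v t) = size s + probes t.
Proof. by elim: s => //= a s ->. Qed.

Fixpoint oread_seq (s : seq A) (k : seq bool -> otree A J) : otree A J :=
  if s is a :: s' then
    ORead a (oread_seq s' (fun l => k (false :: l)))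
            (oread_seq s' (fun l => k (true :: l)))
  else k [::].

Lemma probes_oread_seq s k c d : size s = d ->
  (forall l, probes (k l) <= c) -> probes (oread_seq s k) <= d + c.
Proof.
move=> <-; elim: s k => [|a s IH] k lec //=.
by rewrite addSn ltnS geq_max !IH.
Qed.

End OracleTrees.

Section Exec.
Variables (D : dynBase) (S : searchProblem) (n : nat) (A : oalgorithm D S n).
Variables (O : oracle_family S) (I0 : inst D n).

Lemma oexec_owrites s v (m : amem A) h :
  exists2 m' : amem A, (forall a, m' a = if a \in s then v a else m a)
  & forall k, oexec O I0 (owrites s v k) m h = oexec O I0 k m' h.
Proof.
elim: s m => [|a s IH] m /=; first by exists m.
have [m' eqm' eqk] := IH [eta m with a |-> v a]; exists m' => // c.
by rewrite eqm' in_cons /=; case: eqP => [->|] //=; case: ifP.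
Qed.

Lemma oexec_oread_seq s k (m : amem A) h :
  oexec O I0 (oread_seq s k) m h = oexec O I0 (k (map m s)) m h.
Proof. by elim: s k => //= a s IH k; rewrite !IH; case: (m a). Qed.

End Exec.

(** * The First-DT instance built from a verifier *)

Section Reduction.
Variables (D : dynBase) (n : nat) (V : verifier D n).
Notation cell := (vcell D n (plen V) (rlen V) (vwork V)).
Notation init := (@vinit D n V).
Notation FDT := (FirstDT (trunc_log 2) (trunc_log 2)).

Definition inputs (us ps : seq bool) (a : cell) : bool :=
  match a with
  | inl (inl (inl (inl i))) => nth false us i
  | inl (inl (inl (inr i))) => nth false ps i
  | _ => false
  end.

Definition ucells : seq cell := [seq inl (inl (inl (inl i))) | i <- enum 'I_(ulen D n)].
Definition pcells : seq cell := [seq inl (inl (inl (inr i))) | i <- enum 'I_(plen V)].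

Lemma mem_ucells (a : cell) :
  (a \in ucells) = if a is inl (inl (inl (inl _))) then true else false.
Proof.
case: a => [[[[j|j]|j]|j]|j]; try by apply/mapP => -[].
by apply/mapP; exists j; rewrite ?mem_enum.
Qed.

Lemma mem_pcells (a : cell) :
  (a \in pcells) = if a is inl (inl (inl (inr _))) then true else false.
Proof.
case: a => [[[[j|j]|j]|j]|j]; try by apply/mapP => -[].
by apply/mapP; exists j; rewrite ?mem_enum.
Qed.

(** The exact depth of a proof tree: one write per proof bit, the verifier's own tree, one read per
    reward bit. *)
Definition tree_log := plen V + vtime V + rlen V.

(** Ranks must have length exactly [tree_log]; since numerals are least significant bit first,
    appended zeros leave the value of the reward unchanged. For [i] beyond [2 ^ plen V], [bits]
    drops the high bits, so the trees repeat. *)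
Definition proof_tree (i : nat) : dtree nat (seq bool) :=
  renum (writes pcells (inputs [::] (bits (plen V) i)) (vtree V))
    (read_seq [seq nat_of_ord (enum_rank (vcell_y D n (plen V) (vwork V) i))
              | i <- enum 'I_(rlen V)]
      (fun l => l ++ nseq (tree_log - rlen V) false)).

Definition fdt_of (m : vmem V) : fdt_raw :=
  ([seq m a | a <- enum cell], mkseq proof_tree (2 ^ tree_log)).

(** The encoded length depends only on the size of the array and on the trees, not on the memory
    contents, so the all-false memory represents every other one. *)
Definition qsize := size (ser (fdt_of (fun=> false))).

Lemma depth_proof_tree i : depth (proof_tree i) = tree_log.
Proof.
rewrite /proof_tree depth_renum depth_writes depth_read_seq /pcells.
by rewrite !(size_enum_ord, size_map).
Qed.

Lemma wf_proof_tree i : tree_wf #|cell| tree_log (proof_tree i).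
Proof.
apply: wf_renum => //; apply: wf_read_seq.
  by apply/allP => _ /mapP[j _ ->].
move=> l; rewrite size_map size_enum_ord size_cat size_nseq => ->.
by rewrite /tree_log; lia.
Qed.

Lemma fdt_of_subproof m :
  fdt_wf (trunc_log 2) (trunc_log 2) (fdt_of m) && (size (ser (fdt_of m)) == qsize).
Proof.
rewrite /qsize /ser !size_cat !size_ser_mem !size_map eqxx andbT.
rewrite /fdt_wf size_mkseq expn_gt0 /= trunc_expnK // all_map.
apply/allP => i _ /=; rewrite size_map -cardE.
by rewrite wf_proof_tree depth_proof_tree leqnn.
Qed.

Definition fdt_inst_of m : inst FDT qsize := exist _ (fdt_of m) (fdt_of_subproof m).

(** There are [2 ^ L] trees of fewer than [2 ^ L.+1] nodes each, and a node takes at most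
    [2 + w + L <= 2 ^ (w + L + 1)] bits. The final 4 absorbs the constants, the array and the unary
    number of trees. *)
Lemma qsize_le : qsize <= 2 ^ (3 * tree_log + bitlen (vspace V) + 4).
Proof.
have szm : size (fdt_of (fun=> false)).1 = vspace V by rewrite size_map -cardE.
rewrite /qsize /ser !size_cat size_ser_mem szm size_rcons size_nseq.
rewrite size_mkseq size_flatten /shape -!map_comp.
set w := bitlen _; set L := tree_log.
have ltw : vspace V < 2 ^ w by apply: ltn_bitlen.
have letree : sumn [seq (size \o (ser_tree w \o proof_tree)) i | i <- iota 0 (2 ^ L)]
    <= 2 ^ L * (2 ^ L.+1 * (2 + w + L)).
  rewrite -{2}(size_iota 0 (2 ^ L)); elim: (iota 0 (2 ^ L)) => //= i s IH.
  rewrite mulSn leq_add //.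
  have := size_ser_tree w (wf_proof_tree i); rewrite depth_proof_tree -/L; lia.
have lewL : 2 + w + L <= 2 ^ (w + L + 1).
  by have := ltn_expl (w + L + 1) (isT : 1 < 2); lia.
have -> : 3 * L + w + 4 = L + (L + (L + (w + 4))) by lia.
move: (sumn _) letree => T letree; clearbody L w.
move: letree lewL; rewrite !expnD expnS.
have : 0 < 2 ^ L by rewrite expn_gt0.
have : 0 < 2 ^ w by rewrite expn_gt0.
move: (2 ^ L) (2 ^ w) ltw => x y ltw y0 x0 letree lewL.
have -> : 2 ^ 4 = 16 by [].
have : x * (2 * x * (2 + w + L)) <= x * (2 * x * (y * x * 2 ^ 1)).
  by rewrite !leq_mul2l lewL !orbT.
have le1 : y <= x * (x * (x * y)) by rewrite !mulnA leq_pmull // !muln_gt0 x0.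
have le2 : x <= x * (x * (x * y)) by rewrite leq_pmulr // !muln_gt0 x0.
lia.
Qed.

Definition proof_of (i : nat) : (plen V).-tuple bool :=
  Tuple (introT eqP (size_bits (plen V) i)).

(** The update cells of [m] already hold [u], so writing the proof cells completes the verifier's
    input. *)
Lemma exec_proof_writes u (m : vmem V) i :
  (forall j, m (inl (inl (inl (inl j)))) = tnth u j) ->
  (exec (writes pcells (inputs [::] (bits (plen V) i)) (vtree V)) m).1
  =1 vstep m (u, proof_of i).
Proof.
move=> equ a; rewrite exec_writes; apply: exec_ext => {}a; rewrite mem_pcells.
by case: a => [[[[j|j]|j]|j]|j] //=; rewrite (tnth_nth false).
Qed.

Lemma rank_proof_tree u (m : vmem V) i :
  (forall j, m (inl (inl (inl (inl j)))) = tnth u j) ->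
  rank (fdt_of m) (proof_tree i) = vy (vstep m (u, proof_of i)).
Proof.
move=> equ; rewrite /rank /proof_tree.
have [m' eqm' ->] := exec_renum
  (writes pcells (inputs [::] (bits (plen V) i)) (vtree V))
  (read_seq [seq nat_of_ord (enum_rank (vcell_y D n (plen V) (vwork V) i))
              | i <- enum 'I_(rlen V)]
      (fun l => l ++ nseq (tree_log - rlen V) false)) (nth_map_enum m).
rewrite exec_read_seq bval_pad -map_comp; congr bval; apply: eq_map => j /=.
by rewrite eqm' (exec_proof_writes _ equ).
Qed.

(** * The oracle algorithm *)

Definition oracle_size (_ : 'I_1) := qsize.
Notation ocell := (acell D FDT n oracle_size #|cell|).

Definition wcell (a : cell) : ocell := inr (enum_rank a).
Definition qcell (i : 'I_(bitlen qsize)) : ocell :=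
  inl (inl (inr (existT (fun j => 'I_(ulen FDT (oracle_size j))) ord0 i))).
Definition rcell (i : 'I_(bitlen qsize)) : ocell :=
  inl (inr (existT (fun j => 'I_(alen FDT (oracle_size j))) ord0 i)).
Definition ucell (i : 'I_(ulen D n)) : ocell := inl (inl (inl (inl i))).
Definition ocell_out : ocell := inl (inl (inl (inr tt))).

Definition query_bits (q : nat) (a : ocell) : bool :=
  if a is inl (inl (inr (existT _ i))) then nth false (bits (bitlen qsize) q) i
  else false.

Definition call (q : nat) (k : otree ocell 'I_1) : otree ocell 'I_1 :=
  owrites [seq qcell i | i <- enum 'I_(bitlen qsize)] (query_bits q) (OCall ord0 k).

(* Runs [t] on the copy of the verifier's memory kept in the work cells and   *)
(* forwards every bit that changes to the oracle.                             *)
Fixpoint mirror (t : dtree cell unit) (k : otree ocell 'I_1) : otree ocell 'I_1 :=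
  match t with
  | End _ => k
  | Read a t0 t1 => ORead (wcell a) (mirror t0 k) (mirror t1 k)
  | Write a b t' =>
      let k' := mirror t' k in
      let set := OWrite (wcell a) b (call (enum_rank a) k') in
      if b then ORead (wcell a) set k' else ORead (wcell a) k' set
  end.

(** The oracle's answer is read once the update is in its array, and before the second [mirror],
    whose calls may overwrite the answer array; from then on [r] lives in the branch of the tree
    taken, not in memory. *)
Definition step_tree : otree ocell 'I_1 :=
  oread_seq [seq ucell i | i <- enum 'I_(ulen D n)] (fun us =>
  mirror (writes ucells (inputs us [::]) (End _ tt))
  (oread_seq [seq rcell i | i <- enum 'I_(bitlen qsize)] (fun r =>
  mirror (writes pcells (inputs [::] (bits (plen V) (bval r))) (vtree V))
  (ORead (wcell (vcell_x _ _ _ _ _))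
     (OWrite ocell_out false (OEnd _ _)) (OWrite ocell_out true (OEnd _ _)))))).

(** The default branch serves the output bit, which holds the verifier's output of step 0; [astart]
    fills the answer array afterwards. *)
Definition start_mem (I0 : inst D n) (a : ocell) : bool :=
  match a with
  | inr i => init I0 (enum_val i)
  | _ => @vx D n V (init I0)
  end.

Definition first_dt_alg : oalgorithm D FDT n :=
  @OAlgorithm D FDT n 1 oracle_size #|cell| (fun I0 _ => @fdt_inst_of (init I0)) start_mem step_tree.

(** * Time and space of the algorithm *)

Lemma probes_mirror t k :
  probes (mirror t k) <= depth t * (2 + bitlen qsize) + probes k.
Proof.
elim: t => [l|a t0 IH0 t1 IH1|a b t IH] //=.
  move: (probes (mirror t0 k)) (probes (mirror t1 k)) (probes k) IH0 IH1 => p0 p1 p IH0 IH1.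
  move: (2 + bitlen qsize) (leq_addr (bitlen qsize) 2) IH0 IH1 => c c2 IH0 IH1.
  have : depth t0 * c <= maxn (depth t0) (depth t1) * c by rewrite leq_mul2r leq_maxl orbT.
  have : depth t1 * c <= maxn (depth t0) (depth t1) * c by rewrite leq_mul2r leq_maxr orbT.
  rewrite mulSn; move: (maxn (depth t0) _ * c) (depth t0 * c) (depth t1 * c) IH0 IH1 => *.
  lia.
(* A write that changes a bit costs the read of the old bit, the write itself, and one write per bit
   of the query array; the oracle call is free. *)
have pc : probes (call (enum_rank a) (mirror t k)) = bitlen qsize + probes (mirror t k).
  by rewrite probes_owrites size_map size_enum_ord.
case: b => /=; rewrite pc mulSn; move: IH; move: (probes (mirror t k)) (depth t * _) (probes k) => *; lia.
Qed.

Lemma atime_first_dt_alg :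
  atime first_dt_alg <=
  ulen D n + ulen D n * (2 + bitlen qsize) + bitlen qsize
  + (plen V + vtime V) * (2 + bitlen qsize) + 2.
Proof.
rewrite /atime /= /step_tree -!addnA.
apply: probes_oread_seq => [|us]; first by rewrite size_map size_enum_ord.
apply: leq_trans (probes_mirror _ _) _.
rewrite depth_writes size_map size_enum_ord addn0 leq_add2l.
apply: probes_oread_seq => [|r]; first by rewrite size_map size_enum_ord.
apply: leq_trans (probes_mirror _ _) _.
by rewrite depth_writes size_map size_enum_ord leq_add2l.
Qed.

Lemma aspace_first_dt_alg :
  aspace first_dt_alg = ulen D n + 1 + bitlen qsize + bitlen qsize + vspace V.
Proof.
rewrite /aspace /acell !card_sum !card_ord card_unit !card_tagged /=.
by rewrite !enum_ordSl !enum_ord0 /= !card_ord !addn0.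
Qed.

(** * Correctness of the simulation *)

Variables (O : oracle_family FDT) (I0 : inst D n).
Hypothesis Ocorr : oracle_correct O.
Notation amem := (amem first_dt_alg).
Notation ahist := (ahist first_dt_alg).

Notation run := (@oexec D FDT n first_dt_alg O I0).

(** The simulation invariant. Its last field ties the stored answer to the whole current history, so
    the answer is up to date even if copying the update changed no bit and made no call. *)
Record mirrors (vm : vmem V) (m : amem) (h : ahist) : Prop := Mirrors {
  mirrors_work : forall a, m (wcell a) = vm a;
  mirrors_inst : exists2 J, nexts (@fdt_inst_of (init I0)) (h ord0) = Some J
                          & val J = fdt_of vm;
  mirrors_answer : forall i,
    m (rcell i) = tnth (O (@fdt_inst_of (init I0)) (h ord0)) i }.

Lemma mirrors_ext vm vm' m h : vm =1 vm' -> mirrors vm m h -> mirrors vm' m h.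
Proof.
move=> eqv [Hw [J HJ eqJ] Ha]; split=> //; first by move=> a; rewrite Hw.
by exists J => //; rewrite eqJ /fdt_of (eq_map eqv).
Qed.

Lemma card_cell_le : #|cell| <= qsize.
Proof.
rewrite /qsize /ser size_cat size_ser_mem size_map -cardE.
by apply: leq_trans (leq_addr _ _); rewrite -addnn -addnS leq_addr.
Qed.

(** The query is the position of [a] in the array. As the bit really changes, the flip performed by
    the oracle agrees with the write. *)
Lemma oexec_call vm a b (m : amem) h :
  mirrors vm m h -> vm a != b ->
  exists m' h', mirrors [eta vm with a |-> b] m' h'
    /\ forall k, run (call (enum_rank a) k) ([eta m with wcell a |-> b] : amem) h
       = run k m' h'.
Proof.
move=> [Hw [J HJ eqJ] Ha] neqb; 
have [m2 eqm2 eqrun] := @oexec_owrites D FDT n first_dt_alg O I0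
  [seq qcell i | i <- enum 'I_(bitlen qsize)] (query_bits (enum_rank a))
  [eta m with wcell a |-> b] h.
pose q : upd FDT qsize := @aquery _ _ _ first_dt_alg m2 ord0.
have eqq : bval q = enum_rank a.
  rewrite -[RHS](@bitsK (bitlen qsize)); last first.
    (* The position fits into the query array because an encoded instance is at least as long as its
       memory array. *)
    by apply: ltn_bitlen; apply: leq_trans card_cell_le; apply: ltnW.
  congr bval; apply: (@eq_from_nth _ false); rewrite size_tuple ?size_bits // => i lti.
  rewrite -(tnth_nth false q (Ordinal lti)) tnth_mktuple eqm2.
  by rewrite ifT //; apply/mapP; exists (Ordinal lti); rewrite ?mem_enum.
have [J' HJ' eqJ'] : exists2 J', fdt_next J q = Some J' & val J' = flip (val J) (bval q).
  by apply: fdt_nextP; rewrite eqJ eqq size_map -cardE.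
pose h' : ahist := dfwith h (rcons (h ord0) q).
have eqh' : h' ord0 = rcons (h ord0) q by rewrite /h' dfwith_in.
have Hn : nexts (@fdt_inst_of (init I0)) (h' ord0) = Some J'.
  by rewrite eqh' nexts_rcons HJ.
exists (aanswer O I0 m2 h' ord0), h'; split=> [|k]; last by rewrite eqrun /= -/q -/h' Hn.
split=> [c||i] /=.
- rewrite eqm2 /= ifF; last by apply/mapP => -[].
  rewrite -Hw /wcell; case: (eqVneq c a) => [->|neq]; first by rewrite eqxx.
  by rewrite ifF //; apply/eqP => -[/enum_rank_inj] /eqP; rewrite (negPf neq).
- by exists J' => //; rewrite eqJ' eqq eqJ (flip_map_enum _ neqb).
- by [].
Qed.

Lemma oexec_mirror t vm m h : mirrors vm m h ->
  exists m' h', mirrors (exec t vm).1 m' h'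
    /\ forall k, run (mirror t k) m h = run k m' h'.
Proof.
elim: t vm m h => [l|a t0 IH0 t1 IH1|a b t IH] vm m h Hm /=.
- by exists m, h.
- by rewrite (mirrors_work Hm); case: (vm a); [apply: IH1 | apply: IH0].
(* A write that changes nothing makes no call; the memories before and after it agree pointwise. *)
have [eqb|neqb] := eqVneq (vm a) b.
  have ext : vm =1 [eta vm with a |-> b] by move=> c /=; case: eqP => [->|].
  have [m' [h' [Hm' eqo]]] := IH _ _ _ (mirrors_ext ext Hm).
  exists m', h'; split=> // k; rewrite -eqo.
  by case: b eqb {ext Hm' eqo} => eqb /=; rewrite (mirrors_work Hm) eqb.
have [m1 [h1 [Hm1 eq1]]] := oexec_call Hm neqb.
have [m' [h' [Hm' eqo]]] := IH _ _ _ Hm1.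
exists m', h'; split=> // k; rewrite -eqo -eq1.
by case: b neqb {Hm1 Hm' eq1 eqo} => /=; rewrite (mirrors_work Hm); case: (vm a).
Qed.

Lemma astep_first_dt_alg vm m h u : mirrors vm m h ->
  exists p m' h',
  [/\ forall p', vy (vstep vm (u, p')) <= vy (vstep vm (u, p)),
      mirrors (vstep vm (u, p)) m' h',
      aout m' = vx (vstep vm (u, p))
    & astep O I0 (Some (m, h)) u = Some (m', h')].
Proof.
move=> Hm; rewrite /astep /= /step_tree oexec_oread_seq.
set us := map _ _.
have {us}-> : us = u by rewrite /us -map_comp -[RHS]map_tnth_enum; apply: eq_map.
have Hm0 : mirrors vm (ainput u m) h by case: Hm.
have [m1 [h1 [Hm1 ->]]] := oexec_mirror (writes ucells (inputs u [::]) (End _ tt)) Hm0.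
set vm1 := (exec _ _).1 in Hm1.
have eq1 a : vm1 a = if a is inl (inl (inl (inl j))) then tnth u j else vm a.
  rewrite /vm1 exec_writes /= mem_ucells.
  by case: a => [[[[j|j]|j]|j]|j] //=; rewrite (tnth_nth false).
have equ j : vm1 (inl (inl (inl (inl j)))) = tnth u j by rewrite eq1.
(* [vm1] differs from [vm] only in the update cells, which [vinput] overwrites anyway. *)
have eqstep p : vstep vm1 (u, p) =1 vstep vm (u, p).
  by apply: exec_ext => -[[[[j|j]|j]|j]|j] //=; rewrite eq1.
rewrite oexec_oread_seq; set r := map _ _.
have eqr : r = O (@fdt_inst_of (init I0)) (h1 ord0).
  rewrite /r -map_comp -[RHS]map_tnth_enum; apply: eq_map => i.
  exact: (mirrors_answer Hm1).
have [J HJ eqJ] := mirrors_inst Hm1.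
have [] := Ocorr HJ; rewrite -eqr eqJ /= size_mkseq => ltr maxr.
have [m2 [h2 [Hm2 ->]]] := oexec_mirror
  (writes pcells (inputs [::] (bits (plen V) (bval r))) (vtree V)) Hm1.
have {}Hm2 : mirrors (vstep vm (u, proof_of (bval r))) m2 h2.
  by apply: (mirrors_ext _ Hm2) => a; rewrite (exec_proof_writes _ equ) eqstep.
set p := proof_of _ in Hm2; set x := vx (vstep vm (u, p)).
exists p, [eta m2 with ocell_out |-> x], h2; split.
- move=> p'; have eqy p1 : vy (vstep vm (u, p1)) = vy (vstep vm1 (u, p1)).
    by congr bval; apply: eq_map => j; rewrite eqstep.
  (* Every proof is the numeral of some index below the number of trees, so its tree competes in the
     maximum found by the oracle. *)
  have ltp' : bval p' < 2 ^ tree_log.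
    apply: leq_trans (bval_lt _) _; rewrite size_tuple leq_pexp2l //.
    by rewrite /tree_log -addnA leq_addr.
  have := maxr _ ltp'; rewrite !nth_mkseq // !(rank_proof_tree _ equ) !eqy.
  suff -> : proof_of (bval p') = p' by [].
  by apply: val_inj; rewrite /= -[X in bits X](size_tuple p') bits_bval.
- by case: Hm2.
- by [].
- rewrite /= (mirrors_work Hm2) -/(vx _) -/x.
  by case: x.
Qed.

Lemma astart_first_dt_alg :
  mirrors (init I0) (astart first_dt_alg O I0).1 (astart first_dt_alg O I0).2
  /\ aout (astart first_dt_alg O I0).1 = @vx D n V (init I0).
Proof.
rewrite /astart /= enum_ordSl enum_ord0 /=; split=> //; split=> [a||i] /=.
- by rewrite enum_rankK.
- by exists (@fdt_inst_of (init I0)).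
- by [].
Qed.

(** [reward_max] asks for a maximal reward given the memory produced by the earlier proofs, so the
    oracle's choices in the single steps chain together. *)
Lemma arun_first_dt_alg us :
  exists ups m h,
  [/\ unzip1 ups = us, reward_max (init I0) ups,
      aout m = vx (vrun I0 ups)
    & arun first_dt_alg O I0 us = Some (m, h)].
Proof.
rewrite /arun /vrun; have [] := astart_first_dt_alg.
case: astart => m h /=; elim: us (init I0) m h => [|u us IH] vm m h Hm Hx.
  by exists [::], m, h.
have [p [m1 [h1 [maxp Hm1 Hx1 eq1]]]] := astep_first_dt_alg u Hm.
have [ups [m' [h' [equ rw Hx' eq']]]] := IH _ _ _ Hm1 Hx1.
exists ((u, p) :: ups), m', h'; split=> //=; first by rewrite equ.
by rewrite -eq' -eq1.
Qed.

End Reduction.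

Theorem mainTheorem10 :
  exists dbound rbound : nat -> nat,
    [/\ O_polylog dbound, O_polylog rbound &
    forall (K : nat -> nat) (D : decProblem),
      O_poly K -> NPdy K D ->
      exists (A : forall n, oalgorithm D (FirstDT dbound rbound) n) (b : nat -> nat),
        [/\ solves_with_oracle K A,
            O_polylog (fun n => atime (A n)),
            O_poly (fun n => aspace (A n)),
            blowup A b &
            O_quasipoly b]].
Proof.
have Olog : O_polylog (trunc_log 2) by apply: O_polylog_log; exists 1, 0 => n _; rewrite mul1n.
exists (trunc_log 2), (trunc_log 2); split=> // K D _ [V [Vt Vs Vp Vr Vver]].
(* The exponent in [qsize_le]. *)
pose G n := 3 * tree_log (V n) + bitlen (vspace (V n)) + 4.
have OG : O_polylog G.
  apply: O_polylogD; last exact: O_polylog_cst.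
  apply: O_polylogD; last exact: O_polylog_bitlen.
  apply: O_polylogM; first exact: O_polylog_cst.
  by apply: O_polylogD => //; apply: O_polylogD.
(* The blow-up is quasipolynomial, but only the length of a position in the oracle's instance enters
   time and space. *)
have Oq : O_polylog (fun n => bitlen (qsize (V n))).
  apply: (@O_polylog_le _ (fun n => G n + 1)); last first.
    by apply: O_polylogD => //; apply: O_polylog_cst.
  move=> n; rewrite addn1 ltnS -[G n](@trunc_expnK 2) //.
  exact/leq_trunc_log/qsize_le.
have Ou : O_polylog (ulen D) by apply/O_polylog_log/ulen_log.
exists (fun n => first_dt_alg (V n)), (fun n => qsize (V n)); split.
- move=> O Ocorr n I0 I us leK eqI.
  (* The proofs found along the run are reward-maximizing, so both conditions on the verifier apply
     to them. *)
  have [ups [m [h [equ rw Hx eqr]]]] := arun_first_dt_alg (V n) I0 Ocorr us.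
  exists m, h; split=> //; rewrite Hx.
  have leK' : size ups <= K n by rewrite -(size_map fst) -/(unzip1 ups) equ.
  rewrite -equ in eqI; have [Hf Ht] := Vver n I0 I ups leK' eqI.
  by case E: (accepts I); [apply: Ht | apply: Hf].
- apply: O_polylog_le (fun n => atime_first_dt_alg (V n)) _.
  have O2 : O_polylog (fun n => 2 + bitlen (qsize (V n))).
    by apply: O_polylogD => //; apply: O_polylog_cst.
  do 4?[apply: O_polylogD => //]; do ?[exact: O_polylog_cst | apply: O_polylogM => //].
  exact: O_polylogD.
- have [k [c [n0 H]]] : O_poly (fun n => ulen D n + 1 + bitlen (qsize (V n))
     + bitlen (qsize (V n)) + vspace (V n)).
    apply: O_polyD => //; apply: O_poly_polylog.
    do 3?[apply: O_polylogD => //]; exact: O_polylog_cst.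
  by exists k, c, n0 => n /H; rewrite aspace_first_dt_alg.
- by move=> n j.
- exists G => //; exists 1, 0 => n _; rewrite mul1n; exact: qsize_le.
Qed.
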